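(* Let $$Z(s)=\frac{a_3s^3+a_2s^2+a_1s+a_0}{d_3s^3+d_2s^2+d_1s+d_0}$$ with $a_i,d_j>0$ for $i,j=0,1,2,3$, McMillan degree $\delta(Z(s))=3$, and no pole or zero on $j\mathbb{R}\cup\infty$. Then any network whose impedance is $Z(s)$ contains at least five elements, of which at least three are energy storage elements.
   Context: Networks are two-terminal linear time-invariant networks consisting of dampers, springs and inerters with positive finite element values: a finite connected graph (multiple edges allowed) with two distinguished vertices $a,a'$ (the terminals), each edge being one element. The impedance of a network is its driving-point impedance (velocity plays the role of voltage, force the role of current); a damper $c>0$ has impedance $1/c$, a spring $k>0$ has impedance $s/k$, an inerter $b>0$ has impedance $1/(bs)$. Springs and inerters are called energy storage elements. For $Z=a/d$ with coprime polynomials $a,d$, the McMillan degree is $\delta(Z)=\max\{\deg a,\deg d\}$. *)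

(* Defs.v *)
From HB Require Import structures.
From mathcomp Require Import all_boot all_order all_algebra.
From mathcomp Require Import generic_quotient reals.
From mathcomp.real_closed Require Import complex.

Set Implicit Arguments.
Unset Strict Implicit.
Unset Printing Implicit Defensive.

Import Order.TTheory GRing.Theory Num.Theory.
Local Open Scope ring_scope.
Local Open Scope quotient_scope.

(* Real-rational functions of the complex frequency s; s itself is 'X%:F.     *)
Notation ratfun R := {fraction {poly R}}.
Notation "x %:F" := (tofrac x) : ring_scope.

(* Numerator and denominator in lowest terms, determined up to a common       *)
(* nonzero constant: the representative chosen by the quotient construction   *)
(* need not be reduced, so its gcd is divided out.                            *)
Definition rf_num (R : fieldType) (Z : ratfun R) : {poly R} :=
  \n_(repr Z) %/ gcdp \n_(repr Z) \d_(repr Z).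

Definition rf_den (R : fieldType) (Z : ratfun R) : {poly R} :=
  \d_(repr Z) %/ gcdp \n_(repr Z) \d_(repr Z).

(* (size p).-1 is the degree of p. *)
Definition mcmillan_degree (R : fieldType) (Z : ratfun R) : nat :=
  maxn (size (rf_num Z)).-1 (size (rf_den Z)).-1.

Definition zero_at (R : rcfType) (Z : ratfun R) (z : R[i]) : bool :=
  root (map_poly (real_complex R) (rf_num Z)) z.

Definition pole_at (R : rcfType) (Z : ratfun R) (z : R[i]) : bool :=
  root (map_poly (real_complex R) (rf_den Z)) z.

Definition zero_at_infinity (R : fieldType) (Z : ratfun R) : bool :=
  (size (rf_num Z) < size (rf_den Z))%N.

Definition pole_at_infinity (R : fieldType) (Z : ratfun R) : bool :=
  (size (rf_den Z) < size (rf_num Z))%N.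

(* No pole and no zero on the extended imaginary axis. *)
Definition no_pole_or_zero_on_axis (R : rcfType) (Z : ratfun R) : Prop :=
  (forall z : R[i], complex.Re z = 0 -> ~~ pole_at Z z /\ ~~ zero_at Z z) /\
  ~~ pole_at_infinity Z /\ ~~ zero_at_infinity Z.

Inductive element (R : Type) : Type :=
| Damper of R
| Spring of R
| Inerter of R.

Definition element_value (R : Type) (x : element R) : R :=
  match x with Damper c => c | Spring k => k | Inerter b => b end.

Definition is_storage (R : Type) (x : element R) : bool :=
  if x is Damper _ then false else true.

Definition element_impedance (R : fieldType) (x : element R) : ratfun R :=
  match x with
  | Damper c => 1 / c%:P%:F
  | Spring k => 'X%:F / k%:P%:F
  | Inerter b => 1 / (b%:P%:F * 'X%:F)
  end.

Definition adjacent (V E : finType) (src tgt : E -> V) : rel V :=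
  fun x y => [exists e, ((src e == x) && (tgt e == y))
                     || ((src e == y) && (tgt e == x))].

(* src/tgt only fix a reference direction for each element. *)
Record network (R : numDomainType) := Network {
  vertex : finType;
  edge : finType;
  src : edge -> vertex;
  tgt : edge -> vertex;
  elt : edge -> element R;
  term1 : vertex;
  term2 : vertex;
  _ : forall e, 0 < element_value (elt e);
  _ : term1 != term2;
  _ : forall x y, connect (adjacent src tgt) x y
}.

(* v gives the vertex velocities and f the element forces (oriented from src  *)
(* to tgt) when an external force J enters at term1 and leaves at term2: the  *)
(* law of each element, and the balance of forces at each vertex.             *)
Definition network_solution (R : numFieldType) (N : network R)
    (v : vertex N -> ratfun R) (f : edge N -> ratfun R) (J : ratfun R) : Prop :=
  (forall e, v (src e) - v (tgt e) = element_impedance (elt e) * f e) /\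
  (forall x, \sum_(e | src e == x) f e - \sum_(e | tgt e == x) f e
             = (x == term1 N)%:R * J - (x == term2 N)%:R * J).

(* The pairs (U, J) of velocity and force allowed at the terminals are        *)
(* exactly those with U = Z J.                                                *)
Definition has_impedance (R : numFieldType) (N : network R) (Z : ratfun R) : Prop :=
  forall U J : ratfun R,
    (exists v f, network_solution v f J /\ v (term1 N) - v (term2 N) = U)
    <-> U = Z * J.

Section LowestTerms.
Variable R : fieldType.
Implicit Types (Z : ratfun R) (a d : {poly R}).

Let repr_den_neq0 Z : \d_(repr Z) != 0.
Proof. exact: denom_ratioP. Qed.

Let gcd_repr_neq0 Z : gcdp \n_(repr Z) \d_(repr Z) != 0.
Proof. by rewrite gcdp_eq0 negb_and repr_den_neq0 orbT. Qed.

Lemma rf_den_neq0 Z : rf_den Z != 0.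
Proof.
apply: contraNneq (repr_den_neq0 Z) => den0.
by rewrite -(divpK (dvdp_gcdr \n_(repr Z) \d_(repr Z))) -/(rf_den Z) den0 mul0r.
Qed.

Lemma rf_coprime Z : coprimep (rf_num Z) (rf_den Z).
Proof. by apply: coprimep_div_gcd; rewrite repr_den_neq0 orbT. Qed.

Lemma rf_numdenE Z : Z = (rf_num Z)%:F / (rf_den Z)%:F.
Proof.
have defZ : Z = (\n_(repr Z))%:F / (\d_(repr Z))%:F.
  apply: (canRL (mulfK _)); first by rewrite tofrac_eq0 repr_den_neq0.
  rewrite -{1}[Z]reprK; unlock tofrac.
  rewrite -[LHS]FracField.pi_mul; apply/eqmodP => /=.
  rewrite FracField.equivfE /FracField.mulf.
  by rewrite !numden_Ratio ?mulr1 ?oner_neq0 ?mul1r ?repr_den_neq0 // mulrC.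
apply: (canRL (mulfK _)); first by rewrite tofrac_eq0 rf_den_neq0.
rewrite {1}defZ mulrAC; apply: (canLR (mulfK _)).
  by rewrite tofrac_eq0 repr_den_neq0.
rewrite -!tofracM; congr tofrac.
rewrite -{1}(divpK (dvdp_gcdl \n_(repr Z) \d_(repr Z))) -/(rf_num Z).
rewrite -{2}(divpK (dvdp_gcdr \n_(repr Z) \d_(repr Z))) -/(rf_den Z).
by rewrite mulrAC mulrA.
Qed.

Lemma rf_eqp a d : d != 0 -> coprimep a d ->
  (rf_num (a%:F / d%:F) %= a) && (rf_den (a%:F / d%:F) %= d).
Proof.
move=> d0 cad; set Z := a%:F / d%:F.
have cZ := rf_coprime Z; have dZ := rf_den_neq0 Z.
have E : a * rf_den Z = rf_num Z * d.
  apply/eqP; rewrite -tofrac_eq !tofracM -eqr_div ?tofrac_eq0 //.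
  by rewrite -rf_numdenE.
apply/andP; split; apply/andP; split.
- by rewrite -(Gauss_dvdpl a cZ) E dvdp_mulr.
- by rewrite -(Gauss_dvdpl (rf_num Z) cad) -E dvdp_mulr.
- by rewrite -(@Gauss_dvdpr _ _ (rf_num Z)) 1?coprimep_sym // -E dvdp_mull.
- by rewrite -(@Gauss_dvdpr _ _ a) 1?coprimep_sym // E dvdp_mull.
Qed.

Lemma mcmillan_degreeE a d : d != 0 -> coprimep a d ->
  mcmillan_degree (a%:F / d%:F) = maxn (size a).-1 (size d).-1.
Proof.
move=> d0 cad; have /andP[/eqp_size En /eqp_size Ed] := rf_eqp d0 cad.
by rewrite /mcmillan_degree En Ed.
Qed.

End LowestTerms.

(* Main.v *)
(* Cramer's rule for the linear system of the network gives Z = U / D, where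
   D and U are determinants of matrices with monomial entries, in which only
   the laws of the storage elements involve s, with degree at most 1; so the
   degrees of U and D are at most the number m of storage elements, and m >= 3.
   Without dampers Z is odd, which is impossible with positive coefficients.
   The remaining case is m = 3 with one damper.  Then U and D are constant
   multiples of the given cubics, so their extreme coefficients are nonzero.  A
   nonzero term of the Leibniz expansion matches equations to unknowns, and its
   exponent tells whether each storage law is matched to a velocity or to a
   force.  Counting in D and U at degree 3 (springs open, inerters shorted)
   gives #inerters = #vertices - 2, and at degree 0 #springs = #vertices - 2,
   so that m would be even. *)
Require Import Defs.
From mathcomp Require Import all_boot all_order all_fingroup all_algebra.
From mathcomp Require Import reals.
From mathcomp Require Import ring zify.

Set Implicit Arguments.
Unset Strict Implicit.
Unset Printing Implicit Defensive.

Import Order.TTheory GRing.Theory Num.Theory.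
Local Open Scope ring_scope.

(** * Determinants of matrices indexed by a finite type *)

Section FinTypeMatrix.
Variable T : finType.

Definition fmatrix (A : Type) (K : T -> T -> A) : 'M[A]_#|T| :=
  \matrix_(i, j) K (enum_val i) (enum_val j).

Lemma det_fmatrix_row (A : comNzRingType) (K : T -> T -> A) (t i : T) :
  \sum_j K i j * cofactor (fmatrix K) (enum_rank t) (enum_rank j)
    = (i == t)%:R * \det (fmatrix K).
Proof.
have /matrixP/(_ (enum_rank i) (enum_rank t)) := mul_mx_adj (fmatrix K).
rewrite !mxE (inj_eq enum_rank_inj) mulr_natl => <-.
rewrite (reindex (@enum_rank T)) /=; last first.
  by exists enum_val => ? _; [apply: enum_rankK | apply: enum_valK].
by apply: eq_bigr => j _; rewrite !mxE !enum_rankK.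
Qed.

Lemma cofactor_fmatrix_eq (A : comNzRingType) (K L : T -> T -> A) (t j : T) :
  (forall i k, i != t -> K i k = L i k) ->
  cofactor (fmatrix K) (enum_rank t) (enum_rank j)
    = cofactor (fmatrix L) (enum_rank t) (enum_rank j).
Proof.
move=> eqKL; rewrite /cofactor; congr (_ * \det _); apply/matrixP => i k.
rewrite !mxE; apply: eqKL; apply/eqP => eq_t.
by have /eqP[] := neq_lift (enum_rank t) i; rewrite -{1}eq_t enum_valK.
Qed.

Lemma det_fmatrix_eq0 (F : idomainType) (K : T -> T -> F) :
  \det (fmatrix K) = 0 ->
  exists2 u : T -> F, (exists i, u i != 0) & forall i, \sum_j K i j * u j = 0.
Proof.
move/eqP; rewrite -det_tr => /det0P[u /rV0Pn[k uk0] uK0].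
exists (fun j => u 0 (enum_rank j)).
  by exists (enum_val k); rewrite enum_valK.
move=> i; have /rowP/(_ (enum_rank i)) := uK0; rewrite !mxE; apply: etrans.
rewrite [RHS](reindex (@enum_rank T)) /=; last first.
  by exists enum_val => ? _; [apply: enum_rankK | apply: enum_valK].
by apply: eq_bigr => j _; rewrite !mxE !enum_rankK mulrC.
Qed.

(** Every Leibniz term is a constant times one power of ['X], so a nonzero coefficient of degree [k]
    comes from a nonzero term of exponent exactly [k]. *)
Lemma det_monomial_coef (F : idomainType) (c : T -> T -> F) (r : T -> T -> nat)
    (k : nat) :
  (\det (fmatrix (fun i j => (c i j)%:P * 'X^(r i j))))`_k != 0 ->
  exists s : T -> T,
    [/\ injective s, forall i, c i (s i) != 0 & (\sum_i r i (s i))%N = k].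
Proof.
rewrite /determinant coef_sum => nz.
have [s] : exists s : 'S_#|T|, ((-1) ^+ s * \prod_i fmatrix
    (fun i j => (c i j)%:P * 'X^(r i j)) i (s i))`_k != 0.
  apply/existsP; apply: contraNT nz => /existsPn h.
  by rewrite big1 // => s _; apply/eqP/negPn/h.
pose s' i := enum_val (s (enum_rank i)).
have -> : \prod_i fmatrix (fun i j => (c i j)%:P * 'X^(r i j)) i (s i)
    = \prod_(i : T) ((c i (s' i))%:P * 'X^(r i (s' i))).
  rewrite (reindex (@enum_rank T)) /=; last first.
    by exists enum_val => ? _; [apply: enum_rankK | apply: enum_valK].
  by apply: eq_bigr => i _; rewrite mxE enum_rankK.
rewrite big_split /= -rmorph_prod prodrXr.
rewrite -[-1](rmorphN1 polyC) -rmorphXn /= mulrA -polyCM coefCM coefXn.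
rewrite !mulf_eq0 !negb_or => /andP[/andP[_ nzc]].
case: (k =P _) => [-> _ | _]; last by rewrite eqxx.
exists s'; split=> // [i j /enum_val_inj/perm_inj/enum_rank_inj// | i].
by move/prodf_neq0: nzc; apply.
Qed.

End FinTypeMatrix.

(** * Network equations cleared of denominators *)

Section Tableau.
Variables (R : realFieldType) (N : network R).
Local Notation V := (vertex N).
Local Notation E := (edge N).
Implicit Types (e : E) (x : V) (k : nat).

(** The cleared laws are [c * dv = f] for a damper, [k * dv = s * f] for a spring and
    [b * s * dv = f] for an inerter, [dv] being the velocity difference. *)
Definition vexp (x : element R) : nat := if x is Inerter _ then 1 else 0.
Definition fexp (x : element R) : nat := if x is Spring _ then 1 else 0.
Definition incidence e x : R := (src e == x)%:R - (tgt e == x)%:R.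

Lemma value_gt0 e : 0 < element_value (elt e).
Proof. by case: N e. Qed.

Lemma terms_neq : term1 N != term2 N.
Proof. by case: N. Qed.

Lemma network_connected x y : connect (adjacent (@src R N) (@tgt R N)) x y.
Proof. by case: N x y. Qed.

(* [phi] embeds the element values in the ring [A] and [s] is the frequency;
   the laws are cleared of denominators so that [s] need not be a unit. *)
Definition solution (A : comNzRingType) (phi : R -> A) (s : A)
    (v : V -> A) (f : E -> A) (J : A) : Prop :=
  (forall e, phi (element_value (elt e)) * s ^+ vexp (elt e)
               * (v (src e) - v (tgt e)) = s ^+ fexp (elt e) * f e) /\
  (forall x, \sum_e phi (incidence e x) * f e
               = phi ((x == term1 N)%:R - (x == term2 N)%:R) * J).

Lemma solution_rmorph (A B : comNzRingType) (psi : {rmorphism A -> B})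
    (phi : R -> A) s v f J :
  solution phi s v f J ->
  solution (psi \o phi) (psi s) (psi \o v) (psi \o f) (psi J).
Proof.
move=> [law kcl]; split=> [e | x] /=.
  by rewrite -rmorphB -!rmorphXn -!rmorphM law.
by rewrite -rmorphM -kcl rmorph_sum; apply: eq_bigr => e _; rewrite rmorphM.
Qed.

Lemma solution_network (v : V -> ratfun R) f J :
  solution (@tofrac _ \o polyC) 'X%:F v f J -> network_solution v f J.
Proof.
have eq_divM (F : fieldType) (p q D g : F) :
    p != 0 -> p * D = q * g -> D = q / p * g.
  by move=> p0 pD; rewrite mulrAC -pD mulrAC mulfV // mul1r.
move=> [law kcl]; split=> [e | x].
  have X0 : 'X%:F != 0 :> ratfun R by rewrite tofrac_eq0 polyX_eq0.
  have c0 : (element_value (elt e))%:P%:F != 0.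
    by rewrite tofrac_eq0 polyC_eq0 gt_eqF ?value_gt0.
  have -> : element_impedance (elt e) = 'X%:F ^+ fexp (elt e)
      / ((element_value (elt e))%:P%:F * 'X%:F ^+ vexp (elt e)).
    by case: (elt e) => c /=; rewrite ?expr0 ?expr1 ?mulr1.
  apply: eq_divM (law e).
  exact: mulf_neq0 c0 (expf_neq0 _ X0).
have := kcl x; rewrite /= !rmorphB /= mulrBl !rmorph_nat => <-.
rewrite [\sum_(e | src e == x) _]big_mkcond [\sum_(e | tgt e == x) _]big_mkcond.
rewrite -sumrB; apply: eq_bigr => e _.
rewrite !rmorphB /= !rmorph_nat.
by case: eqP; case: eqP; rewrite !(mulrBl, mul1r, mul0r).
Qed.

(** Without dampers each law has exactly one factor [s], on one side or the other, so its sign is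
    absorbed by reversing all forces. *)
Lemma solution_opp (A : comNzRingType) (phi : R -> A) s v f J :
  (forall e, is_storage (elt e)) ->
  solution phi (- s) v f J -> solution phi s v (fun e => - f e) (- J).
Proof.
move=> sto [law kcl]; split=> [e | x]; last first.
  by rewrite mulrN -kcl -sumrN; apply: eq_bigr => e _; rewrite mulrN.
have := law e; have := sto e; case: (elt e) => // c _ /=;
  rewrite !expr0 !expr1 ?mulr1 ?mul1r.
  by move->; rewrite mulNr mulrN.
by move<-; rewrite mulrN !mulNr opprK.
Qed.

(** * The tableau matrix and its kernel *)

Definition unknown : finType := ((V + E) + unit)%type.
Notation vel x := (inl (inl x) : unknown).
Notation frc e := (inl (inr e) : unknown).
Notation ext := (inr tt : unknown).

(* Row [vel x] is the balance of forces at [x], except that the redundant *)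
(* balance at [term2] gives way to the selection of the driving variable [d]; *)
(* row [frc e] is the law of [e]; row [ext] selects the velocity of [term2]. *)
Definition tab_coef (d i j : unknown) : R :=
  match i, j with
  | inl (inl x), _ =>
      if x == term2 N then (j == d)%:R else
      match j with
      | inl (inl _) => 0
      | inl (inr e) => incidence e x
      | inr _ => - (x == term1 N)%:R
      end
  | inl (inr e), inl (inl x) => element_value (elt e) * incidence e x
  | inl (inr e), inl (inr e') => - (e == e')%:R
  | inl (inr _), inr _ => 0
  | inr _, _ => (j == vel (term2 N))%:R
  end.

Definition tab_expo (i j : unknown) : nat :=
  match i, j with
  | inl (inr e), inl (inl _) => vexp (elt e)
  | inl (inr e), inl (inr _) => fexp (elt e)
  | _, _ => 0
  end.

Definition tableau (A : comNzRingType) (phi : R -> A) (s : A) (d : unknown) :=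
  fmatrix (fun i j => phi (tab_coef d i j) * s ^+ tab_expo i j).

Lemma sum_unknown (A : nmodType) (F : unknown -> A) :
  \sum_i F i = \sum_x F (vel x) + \sum_e F (frc e) + F ext.
Proof.
rewrite !big_sumType /=; congr (_ + _).
by rewrite (bigD1 tt) //= big1 ?addr0 // => -[].
Qed.

Lemma sum_incidence (A : comNzRingType) (phi : {rmorphism R -> A}) e
    (v : V -> A) :
  \sum_x phi (incidence e x) * v x = v (src e) - v (tgt e).
Proof.
have sum_delta y : \sum_x (y == x)%:R * v x = v y.
  rewrite (bigD1 y) //= eqxx mul1r big1 ?addr0 // => x /negbTE.
  by rewrite eq_sym => ->; rewrite mul0r.
rewrite -(sum_delta (src e)) -(sum_delta (tgt e)) -sumrB.
by apply: eq_bigr => x _; rewrite rmorphB !rmorph_nat mulrBl.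
Qed.

Lemma tableau_solution (A : comNzRingType) (phi : {rmorphism R -> A}) s d
    (w : unknown -> A) :
  (forall i, i != vel (term2 N) ->
     \sum_j phi (tab_coef d i j) * s ^+ tab_expo i j * w j = 0) ->
  solution phi s (fun x => w (vel x)) (fun e => w (frc e)) (w ext)
  /\ w (vel (term2 N)) = 0.
Proof.
move=> row0; split; last first.
  have := row0 ext isT; rewrite (bigD1 (vel (term2 N))) //= eqxx big1.
    by rewrite expr0 rmorph1 !mul1r addr0.
  by move=> j /negbTE /= ->; rewrite rmorph0 !mul0r.
split=> [e | x].
  have := row0 (frc e) isT; rewrite sum_unknown /= rmorph0 !mul0r addr0.
  rewrite (bigD1 e) //= eqxx [X in _ + (_ + X)]big1 ?addr0; last first.
    move=> e' /negbTE; rewrite eq_sym => ->.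
    by rewrite rmorphN rmorph0 oppr0 !mul0r.
  rewrite rmorphN rmorph1 mulN1r mulNr => /subr0_eq <-.
  rewrite -(sum_incidence phi e (fun x => w (vel x))) mulr_sumr.
  by apply: eq_bigr => x _; rewrite rmorphM; ring.
have bal y : y != term2 N ->
    \sum_e phi (incidence e y) * w (frc e) = phi (y == term1 N)%:R * w ext.
  move=> /negbTE ny; have := row0 (vel y).
  rewrite (inj_eq inl_inj) (inj_eq inl_inj) ny.
  move=> /(_ isT); rewrite sum_unknown /= ny expr0 big1 ?add0r; last first.
    by move=> z _; rewrite rmorph0 !mul0r.
  rewrite rmorphN !mulr1 mulNr => /subr0_eq <-.
  by apply: eq_bigr => e _; rewrite mulr1.
have [-> | nx] := eqVneq x (term2 N); last by rewrite bal // subr0.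
have: \sum_y \sum_e phi (incidence e y) * w (frc e) = 0.
  rewrite exchange_big /= big1 // => e _.
  have sum0 : \sum_y phi (incidence e y) = 0.
    have := sum_incidence phi e (fun=> 1); rewrite subrr; apply: etrans.
    by apply: eq_bigr => y _; rewrite mulr1.
  by rewrite -mulr_suml sum0 mul0r.
rewrite (bigD1 (term2 N)) //= (eq_bigr _ bal) -mulr_suml.
rewrite (bigD1 (term1 N)) ?terms_neq //= eqxx rmorph1.
rewrite [X in 1 + X]big1 ?addr0 ?mul1r; last first.
  by move=> y /andP[_ /negbTE->]; rewrite rmorph0.
move/eqP; rewrite addr_eq0 => /eqP->.
by rewrite eq_sym (negbTE terms_neq) sub0r rmorphN rmorph1 mulN1r.
Qed.

(* At s = 1 every element acts as a damper, and none can dissipate power since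
   no power is supplied at the terminals. *)
Lemma unforced_solution_eq0 (v f : _ -> R) :
  solution idfun 1 v f 0 -> v (term2 N) = 0 ->
  (forall x, v x = 0) /\ (forall e, f e = 0).
Proof.
move=> [law kcl] v0.
have fE e : f e = element_value (elt e) * (v (src e) - v (tgt e)).
  by have := law e; rewrite /= !expr1n mulr1 mul1r.
have power0 : \sum_e element_value (elt e) * (v (src e) - v (tgt e)) ^+ 2 = 0.
  transitivity (\sum_e \sum_x v x * (incidence e x * f e)).
    apply: eq_bigr => e _.
    rewrite expr2 mulrA -fE -(sum_incidence idfun) mulr_sumr.
    by apply: eq_bigr => x _ /=; ring.
  rewrite exchange_big big1 // => x _; rewrite -mulr_sumr.
  by have /= -> := kcl x; rewrite !mulr0.
have dv0 e : v (src e) = v (tgt e).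
  have ge0 e' : true ->
      0 <= element_value (elt e') * (v (src e') - v (tgt e')) ^+ 2.
    by move=> _; rewrite mulr_ge0 ?sqr_ge0 // ltW ?value_gt0.
  have /(_ e isT)/eqP := psumr_eq0P ge0 power0.
  by rewrite mulf_eq0 gt_eqF ?value_gt0 //= sqrf_eq0 subr_eq0 => /eqP.
split=> [x | e]; last by rewrite fE dv0 subrr mulr0.
(* The velocity is constant across each element, hence along a path from [term2], where it
   vanishes. *)
have /connectP[p] := network_connected (term2 N) x.
elim: p (term2 N) v0 => [y vy _ -> // | y p IHp z vz /=].
move=> /andP[/existsP[e adj_e] /IHp]; apply; rewrite -vz.
by case/orP: adj_e => /andP[/eqP<- /eqP<-]; rewrite dv0.
Qed.

(** * Cramer's rule over the polynomials *)

Notation poly_tableau := (@tableau {poly R} polyC 'X).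

(** Evaluate at [s = 1]: the driving row selects [ext], so a kernel vector there is a solution with
    zero external force, hence zero. *)
Lemma poly_tableau_neq0 : \det (poly_tableau ext) != 0.
Proof.
apply/eqP => /(congr1 (horner_eval 1)); rewrite rmorph0 -det_map_mx.
have -> : map_mx (horner_eval 1) (poly_tableau ext)
    = fmatrix (fun i j => idfun (tab_coef ext i j) * 1 ^+ tab_expo i j).
  apply/matrixP => i j; rewrite !mxE /=.
  by rewrite /horner_eval hornerM hornerC hornerXn.
move=> /det_fmatrix_eq0[u [i /eqP ui] u0]; apply: ui.
have [j _ | sol v0] := @tableau_solution R idfun 1 ext u; first exact: u0.
have J0 : u ext = 0.
  have := u0 (vel (term2 N)).
  rewrite (bigD1 ext) //= eqxx expr0 !mul1r big1 ?addr0 //.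
  by move=> j /negbTE/= ->; rewrite !mul0r.
rewrite J0 in sol; have [vel0 frc0] := unforced_solution_eq0 sol v0.
by case: i => [[x | e] | []].
Qed.

(* These cofactors ignore the driving row, hence any driving variable [d] *)
(* could replace [ext] here: this is what makes [cramerE] hold for every [d]. *)
Definition cramer (i : unknown) : {poly R} :=
  cofactor (poly_tableau ext) (enum_rank (vel (term2 N))) (enum_rank i).

Lemma cramerE d : cramer d = \det (poly_tableau d).
Proof.
have := det_fmatrix_row (fun i j => (tab_coef d i j)%:P * 'X ^+ tab_expo i j)
  (vel (term2 N)) (vel (term2 N)).
rewrite eqxx mul1r => <-; rewrite (bigD1 d) //= !eqxx expr0 !mul1r big1 ?addr0.
  apply: cofactor_fmatrix_eq => -[[x | e] | []] j //=.
  by rewrite (inj_eq inl_inj) (inj_eq inl_inj) => /negbTE->.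
by move=> j /negbTE /= ->; rewrite !mul0r.
Qed.

(** The cofactors of the driving row are orthogonal to every other row, which gives a polynomial
    solution without any division. *)
Lemma cramer_solution :
  solution polyC 'X (fun x => cramer (vel x)) (fun e => cramer (frc e))
    (cramer ext) /\ cramer (vel (term2 N)) = 0.
Proof.
apply: (@tableau_solution _ polyC 'X ext) => i it.
have := det_fmatrix_row (fun i j => (tab_coef ext i j)%:P * 'X ^+ tab_expo i j)
  (vel (term2 N)) i.
by rewrite (negbTE it) mul0r.
Qed.

Lemma impedance_solution (Z : ratfun R) (v : V -> {poly R}) f J :
  has_impedance N Z -> solution polyC 'X v f J ->
  (v (term1 N) - v (term2 N))%:F = Z * J%:F.
Proof.
move=> /(_ _ J%:F) impZ sol; apply/impZ.
exists (@tofrac _ \o v), (@tofrac _ \o f); split; last by rewrite /= rmorphB.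
exact/solution_network/(solution_rmorph (@tofrac _) sol).
Qed.

(** * Counting in the nonzero terms of the determinants *)

Notation storage := [set e : E | is_storage (elt e)].
Notation springs := [set e : E | fexp (elt e) == 1%N].
Notation inerters := [set e : E | vexp (elt e) == 1%N].

Lemma card_storage : #|storage| = (#|springs| + #|inerters|)%N.
Proof.
rewrite -cardsUI -[LHS]addn0; congr (_ + _)%N.
  by apply: eq_card => e; rewrite !inE; case: (elt e).
apply/esym/eqP; rewrite cards_eq0; apply/eqP/setP => e.
by rewrite !inE; case: (elt e).
Qed.

Lemma card_unknown (P : pred unknown) :
  #|[set i | P i]|
    = (#|[set x | P (vel x)]| + #|[set e | P (frc e)]| + P ext)%N.
Proof.
rewrite -!sum1_card !big_mkcond sum_unknown.
congr (_ + _ + _)%N; last by rewrite inE; case: (P _).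
  by rewrite [RHS]big_mkcond; apply: eq_bigr => x _; rewrite !inE.
by rewrite [RHS]big_mkcond; apply: eq_bigr => e _; rewrite !inE.
Qed.

Definition is_vel (i : unknown) : bool :=
  if i is inl (inl _) then true else false.

Lemma tab_expo_storage e (j : unknown) :
  (tab_expo (frc e) j <= is_storage (elt e))%N.
Proof. by case: j => [[x|e']|[]] /=; case: (elt e). Qed.

(** The matching behind a nonzero Leibniz term of degree [k]; only the rows of the element laws
    carry powers of ['X]. *)
Definition transversal d k (s : unknown -> unknown) : Prop :=
  [/\ injective s, forall i, tab_coef d i (s i) != 0
    & (\sum_e tab_expo (frc e) (s (frc e)))%N = k].

Lemma cramer_transversal d k :
  (cramer d)`_k != 0 -> exists s, transversal d k s.
Proof.
rewrite cramerE => /det_monomial_coef[s [inj_s nz <-]]; exists s; split=> //.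
by rewrite sum_unknown /= [X in X + _ + _]big1 // add0r addr0.
Qed.

Lemma size_cramer d : (size (cramer d) <= #|storage|.+1)%N.
Proof.
apply/leq_sizeP => k lt_k; apply/eqP; apply: contraTT lt_k.
move=> /cramer_transversal[s [_ _ <-]].
rewrite -leqNgt -sum1_card [X in (_ <= X)%N]big_mkcond.
by apply: leq_sum => e _; rewrite inE; apply: tab_expo_storage.
Qed.

Lemma transversal_max d s e : transversal d #|storage| s ->
  tab_expo (frc e) (s (frc e)) = is_storage (elt e).
Proof.
move=> [_ _ sum_s]; have := leqif_sum (fun e' (_ : true) =>
  leqif_eq (tab_expo_storage e' (s (frc e')))).
have -> : (\sum_(e1 : E) is_storage (elt e1))%N = #|storage|.
  by rewrite -sum1_card [RHS]big_mkcond; apply: eq_bigr => e1 _; rewrite inE.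
by rewrite sum_s => -[_]; rewrite eqxx => /esym/forall_inP/(_ e isT)/eqP.
Qed.

Lemma transversal_min d s e : transversal d 0 s ->
  tab_expo (frc e) (s (frc e)) = 0%N.
Proof.
by move=> [_ _ /eqP]; rewrite sum_nat_eq0 => /forall_inP/(_ e isT)/eqP.
Qed.

Lemma transversal_card d k s (P Q : pred unknown) : transversal d k s ->
  (forall i, P i -> Q (s i)) -> (#|[set i | P i]| <= #|[set i | Q i]|)%N.
Proof.
move=> [inj_s _ _] PQ; rewrite -(card_imset [set i | P i] inj_s).
apply/subset_leq_card/subsetP => j /imsetP[i Pi ->].
by move: Pi; rewrite !inE; apply: PQ.
Qed.

(** Every vertex row, including the driving row since it selects [ext], is matched to a force.
    Together with the laws in [S] these rows inject into the [#|E| + 1] forces, [ext] included. *)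
Lemma transversal_force_count k s (S : {set E}) : transversal ext k s ->
  {in S, forall e, ~~ is_vel (s (frc e))} -> (#|V| + #|S| <= #|E|.+1)%N.
Proof.
move=> tr_s S_frc; have [_ nz _] := tr_s.
have := @transversal_card _ _ _
  (fun i => match i with
            | inl (inl _) => true | inl (inr e) => e \in S | inr _ => false
            end)
  (fun i => ~~ is_vel i) tr_s.
rewrite !card_unknown !cardsE /= card0 add0n addn0 addn1; apply.
move=> [[x | e] | []] //; last exact: S_frc.
move=> _; have /= := nz (vel x); case: (s _) => [[y | e] | []] //=.
by case: ifP => _; rewrite eqxx.
Qed.

(** The driving row takes the velocity of [term1] and row [ext] that of [term2], leaving [#|V| - 2]
    velocities for the laws in [S]. *)
Lemma transversal_velocity_count k s (S : {set E}) :
  transversal (vel (term1 N)) k s ->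
  {in S, forall e, is_vel (s (frc e))} -> (#|S| + 2 <= #|V|)%N.
Proof.
move=> tr_s S_vel; have [_ nz _] := tr_s.
have := @transversal_card _ _ _
  (fun i => match i with
            | inl (inl x) => x == term2 N
            | inl (inr e) => e \in S
            | inr _ => true
            end)
  is_vel tr_s.
rewrite !card_unknown !cardsE /= card0 !addn0 card1 add1n addn1 addn2; apply.
move=> [[x | e] | []].
- move=> /eqP->; have /= := nz (vel (term2 N)); rewrite eqxx.
  by case: (s _ =P _) => [-> // | _]; rewrite eqxx.
- exact: S_vel.
by move=> _; have /= := nz ext; case: (s _ =P _) => [-> // | _]; rewrite eqxx.
Qed.

(** A spring law has its ['X] on the force side, so exponent 0 means a velocity; the nonzero
    coefficient excludes the column [ext]. *)
Lemma spring_velocity d s e : tab_coef d (frc e) (s (frc e)) != 0 ->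
  fexp (elt e) == 1%N ->
  is_vel (s (frc e)) = (tab_expo (frc e) (s (frc e)) == 0%N).
Proof.
by case: (s (frc e)) => [[x|e']|[]] /=; case: (elt e) => //=; rewrite ?eqxx.
Qed.

Lemma inerter_velocity d s e : tab_coef d (frc e) (s (frc e)) != 0 ->
  vexp (elt e) == 1%N ->
  is_vel (s (frc e)) = (tab_expo (frc e) (s (frc e)) == 1%N).
Proof.
by case: (s (frc e)) => [[x|e']|[]] /=; case: (elt e) => //=; rewrite ?eqxx.
Qed.

Lemma one_damper_even : #|E| = #|storage|.+1 ->
  (cramer ext)`_0 != 0 -> (cramer ext)`_#|storage| != 0 ->
  (cramer (vel (term1 N)))`_0 != 0 ->
  (cramer (vel (term1 N)))`_#|storage| != 0 ->
  ~~ odd #|storage|.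
Proof.
move=> cardE /cramer_transversal[s1 tr1] /cramer_transversal[s2 tr2].
move=> /cramer_transversal[s3 tr3] /cramer_transversal[s4 tr4].
have nz1 := let: And3 _ nz _ := tr1 in nz.
have nz2 := let: And3 _ nz _ := tr2 in nz.
have nz3 := let: And3 _ nz _ := tr3 in nz.
have nz4 := let: And3 _ nz _ := tr4 in nz.
have c1 : (#|V| + #|inerters| <= #|E|.+1)%N.
  apply: (transversal_force_count tr1) => e; rewrite inE => he.
  by rewrite (inerter_velocity (nz1 _)) // (transversal_min e tr1).
have c2 : (#|V| + #|springs| <= #|E|.+1)%N.
  apply: (transversal_force_count tr2) => e; rewrite inE => he.
  rewrite (spring_velocity (nz2 _)) // (transversal_max e tr2).
  by case: (elt e) he.
have c3 : (#|springs| + 2 <= #|V|)%N.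
  apply: (transversal_velocity_count tr3) => e; rewrite inE => he.
  by rewrite (spring_velocity (nz3 _)) // (transversal_min e tr3).
have c4 : (#|inerters| + 2 <= #|V|)%N.
  apply: (transversal_velocity_count tr4) => e; rewrite inE => he.
  rewrite (inerter_velocity (nz4 _)) // (transversal_max e tr4).
  by case: (elt e) he.
(* As [#|E| = #|springs| + #|inerters| + 1], [c1] and [c3] give [#|springs| + 2 = #|V|], while [c2]
   and [c4] give [#|inerters| + 2 = #|V|]. *)
have eq_si : #|springs| = #|inerters|.
  by move: cardE c1 c2 c3 c4; rewrite card_storage; lia.
by rewrite card_storage eq_si addnn odd_double.
Qed.

(** * Comparison with the given impedance; the case without dampers *)

Lemma impedance_cross (Z : ratfun R) (a d : {poly R}) v f J :
  has_impedance N Z -> d != 0 -> Z = a%:F / d%:F -> solution polyC 'X v f J ->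
  (v (term1 N) - v (term2 N)) * d = a * J.
Proof.
move=> impZ d0 defZ /(impedance_solution impZ); rewrite defZ => UJ.
apply/eqP; rewrite -tofrac_eq !tofracM UJ -!mulrA [_^-1 * _]mulrC -mulrA.
by rewrite divff ?mulr1 ?tofrac_eq0.
Qed.

(** Substituting [- 'X] and reversing forces gives another solution, so
    [a(-s) d(s) + a(s) d(-s) = 0]; the constant term of this is twice the product in question. *)
Lemma lossless_impedance (Z : ratfun R) (a d : {poly R}) :
  (forall e, is_storage (elt e)) -> has_impedance N Z ->
  d != 0 -> Z = a%:F / d%:F -> a`_0 * d`_0 = 0.
Proof.
move=> sto impZ d0 defZ; have [sol vt20] := cramer_solution.
pose flip : {rmorphism {poly R} -> {poly R}} := comp_poly (- 'X).
have flip_coef0 (p : {poly R}) : (flip p)`_0 = p`_0.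
  by rewrite -!horner_coef0 horner_comp !hornerE oppr0.
have sol' : solution polyC 'X (flip \o (fun x => cramer (vel x)))
    (fun e => - flip (cramer (frc e))) (- flip (cramer ext)).
  apply: (solution_opp sto); have := solution_rmorph flip sol.
  rewrite /= comp_polyX => -[law kcl].
  by split=> [e | x]; [have := law e | have := kcl x]; rewrite /= comp_polyC;
    [move=> <- | move=> <-; apply: eq_bigr => e _; rewrite comp_polyC].
have := impedance_cross impZ d0 defZ sol'.
rewrite /= vt20 rmorph0 subr0 => cross'.
have /(congr1 flip) := impedance_cross impZ d0 defZ sol.
rewrite vt20 subr0 rmorphM (rmorphM flip a) => cross.
have /eqP : flip (cramer ext) * (flip a * d + a * flip d) = 0.
  transitivity (flip a * flip (cramer ext) * d
      - a * - flip (cramer ext) * flip d); first by ring.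
  by rewrite -cross -cross'; ring.
rewrite mulf_eq0 comp_poly2_eq0 ?size_polyN ?size_polyX //.
rewrite cramerE (negbTE poly_tableau_neq0) /= => /eqP/polyP/(_ 0%N).
rewrite coefD !coef0M !flip_coef0 coef0 => /eqP.
by rewrite -mulr2n mulrn_eq0 => /eqP.
Qed.

End Tableau.

(** * Cubic polynomials and the final case analysis *)

Section Cubic.
Variable R : nzRingType.

Definition cubic (a b c d : R) : {poly R} :=
  a *: 'X^3 + b *: 'X^2 + c *: 'X + d%:P.

Lemma coef_cubic a b c d :
  [/\ (cubic a b c d)`_0 = d, (cubic a b c d)`_3 = a &
    forall i, (3 < i)%N -> (cubic a b c d)`_i = 0].
Proof.
rewrite /cubic.
split=> [||i lt3i]; rewrite !(coefD, coefZ, coefXn, coefX, coefC) /=;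
  rewrite ?(mulr0, mulr1, addr0, add0r) //.
by do 4?[case: i lt3i => // i lt3i]; rewrite /= !mulr0 !addr0.
Qed.

End Cubic.

Theorem lemma4 (R : realType) (a0 a1 a2 a3 d0 d1 d2 d3 : R)
    (ha0 : 0 < a0) (ha1 : 0 < a1) (ha2 : 0 < a2) (ha3 : 0 < a3)
    (hd0 : 0 < d0) (hd1 : 0 < d1) (hd2 : 0 < d2) (hd3 : 0 < d3)
    (Z : {fraction {poly R}})
    (hZ : Z = (a3 *: 'X^3 + a2 *: 'X^2 + a1 *: 'X + a0%:P)%:F
              / (d3 *: 'X^3 + d2 *: 'X^2 + d1 *: 'X + d0%:P)%:F)
    (hdeg : mcmillan_degree Z = 3%N)
    (haxis : no_pole_or_zero_on_axis Z)
    (N : network R) (hN : has_impedance N Z) :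
  (5 <= #|edge N|)%N /\ (3 <= #|[set e : edge N | is_storage (elt e)]|)%N.
Proof.
have [ca0 ca3 ca_gt] := coef_cubic a3 a2 a1 a0.
have [cd0 cd3 cd_gt] := coef_cubic d3 d2 d1 d0.
pose a := cubic a3 a2 a1 a0; pose d := cubic d3 d2 d1 d0.
have size_cubic (p : {poly R}) :
    p`_3 != 0 -> (forall i, (3 < i)%N -> p`_i = 0) -> size p = 4%N.
  move=> p3 p_gt; apply/anti_leq/andP; split.
    by apply/leq_sizeP => i /p_gt.
  by rewrite ltnNge; apply: contra p3 => /leq_sizeP/(_ 3%N)/(_ (leqnn _))->.
have size_a : size a = 4%N by apply: size_cubic ca_gt; rewrite ca3 gt_eqF.
have size_d : size d = 4%N by apply: size_cubic cd_gt; rewrite cd3 gt_eqF.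
have d_neq0 : d != 0 by rewrite -size_poly_gt0 size_d.
have defZ : Z = a%:F / d%:F := hZ.
pose t := inl (inl (term1 N)) : unknown N.
have cross : cramer t * d = a * cramer (inr tt : unknown N).
  have [sol vt20] := cramer_solution N.
  by rewrite -(impedance_cross hN d_neq0 defZ sol) vt20 subr0.
(* Cancelling a nonconstant common factor would leave degree at most 2, against [hdeg]. *)
have cop : coprimep a d.
  have g_neq0 : gcdp a d != 0 by rewrite gcdp_eq0 negb_and d_neq0 orbT.
  have [ga gd] := (dvdp_gcdl a d, dvdp_gcdr a d).
  have d'_neq0 : d %/ gcdp a d != 0 by rewrite dvdp_div_eq0.
  have defZ' : Z = (a %/ gcdp a d)%:F / (d %/ gcdp a d)%:F.
    transitivity ((a %/ gcdp a d * gcdp a d)%:F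
        / (d %/ gcdp a d * gcdp a d)%:F).
      by rewrite !divpK.
    by rewrite !tofracM -mulf_div divff ?mulr1 ?tofrac_eq0.
  have := hdeg.
  rewrite defZ' mcmillan_degreeE ?coprimep_div_gcd ?d_neq0 ?orbT //.
  rewrite !size_divp // size_a size_d maxnn /coprimep => deg3.
  have g_gt0 : (0 < size (gcdp a d))%N by rewrite size_poly_gt0.
  case: (size (gcdp a d)) deg3 g_gt0 => [|[|n]] //=; rewrite subSS => deg3.
  by have := leq_subr n 3; lia.
(* By coprimality [d] divides the denominator determinant; the same cofactor [c] then relates the
   numerator to [a]. *)
have [c defD] : exists c, cramer (inr tt : unknown N) = c * d.
  apply/dvdpP; rewrite -(@Gauss_dvdpr _ _ a d) 1?coprimep_sym //.
  by rewrite -cross dvdp_mull.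
have defU : cramer t = c * a.
  by apply: (mulIf d_neq0); rewrite cross defD; ring.
have c_neq0 : c != 0.
  have := poly_tableau_neq0 N; rewrite -cramerE defD.
  by apply: contraNneq => ->; rewrite mul0r.
set m := #|[set e | _]|; have := size_cramer (inr tt : unknown N); rewrite -/m.
(* The size of [c * d] is [size c + 3], so [size c + 3 <= m + 1]: hence [m >= 3], and [c] is
   constant if [m = 3]. *)
rewrite defD size_mul // size_d addn4 /= => size_c.
have c_gt0 : (0 < size c)%N by rewrite size_poly_gt0.
have m_ge3 : (3 <= m)%N.
  by rewrite -ltnS; apply: leq_trans size_c; rewrite !ltnS.
split=> //; rewrite ltnNge; apply/negP => card4.
have le_m : (m <= #|edge N|)%N by apply: max_card.
(* If every element stores energy, oddness of [Z] contradicts [a0 * d0 > 0]. *)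
have [eq_m | neq_m] := eqVneq m #|edge N|.
  have sto (e : edge N) : is_storage (elt e).
    have /eqP/setP/(_ e) : [set e : edge N | is_storage (elt e)] == setT.
      by rewrite eqEcard subsetT cardsT -eq_m leqnn.
    by rewrite !inE => ->.
  have /eqP := lossless_impedance sto hN d_neq0 defZ.
  by rewrite ca0 cd0 mulf_eq0 !gt_eqF.
have lt_m : (m < #|edge N|)%N by rewrite ltn_neqAle neq_m.
have m3 : m = 3%N.
  by apply/anti_leq; rewrite m_ge3 andbT -ltnS (leq_trans lt_m card4).
have E4 : #|edge N| = 4%N by apply/anti_leq; rewrite card4 -m3.
have /size_poly1P[k k_neq0 defc] : size c == 1%N.
  by move: size_c c_gt0; rewrite m3; case: (size c) => [|[]].
have coef_neq0 (p : {poly R}) i : p`_i != 0 -> (c * p)`_i != 0.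
  by rewrite defc coefCM mulf_eq0 negb_or k_neq0.
(* For constant [c] the determinants keep nonzero coefficients at degrees 0 and 3, which would make
   3 even. *)
have /= := @one_damper_even _ N; rewrite -/m E4 m3 defD -/t defU.
rewrite !coef_neq0 ?ca0 ?cd0 ?ca3 ?cd3 ?gt_eqF // => /(_ erefl).
by do 4!move=> /(_ isT).
Qed.
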